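(* Let $\mathbb{A}\in\mathbb{C}^{n\times n}$, let $\mathbf{X}_m,\mathbf{Y}_m\in\mathbb{C}^{n\times m}$ ($m<n$) satisfy $\mathbf{Y}_m=\mathbb{A}\mathbf{X}_m$, and let $M\in\mathbb{C}^{n\times n}$ be Hermitian positive definite with $M=LL^*$, $L\in\mathbb{C}^{n\times n}$. Let $L^*\mathbf{X}_m=\widetilde{U}\Sigma V^*$ be a thin singular value decomposition, let $k\in\{1,\ldots,m\}$ be such that $\sigma_k>0$, let $\widetilde{U}_k,V_k,\Sigma_k$ be its truncation to the $k$ largest singular values, and let $\widehat{U}_k=L^{-*}\widetilde{U}_k$ be the weighted POD basis. Then the $(\cdot,\cdot)_M$-weighted Rayleigh quotient matrix $\widehat{S}_k=\widehat{U}_k^*M\mathbb{A}\widehat{U}_k$ of $\mathbb{A}$ with respect to $\widehat{U}_k$ can be computed from the available data as $$\widehat{S}_k=\widetilde{U}_k^*L^*\mathbf{Y}_mV_k\Sigma_k^{-1}.$$ If $(\lambda,w)$ is an eigenpair of $\widehat{S}_k$ ($\widehat{S}_kw=\lambda w$, $w\ne0$), then the corresponding Ritz pair $(\lambda,\widehat{U}_kw)$ of $\mathbb{A}$ has the residual norm computable as $$\|\mathbb{A}(\widehat{U}_kw)-\lambda(\widehat{U}_kw)\|_M=\|L^*\mathbf{Y}_mV_k\Sigma_k^{-1}w-\lambda\widetilde{U}_kw\|_2 .$$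
   Context: The inner product is $(x,y)_M=y^*Mx$ on $\mathbb{C}^n$, with norm $\|x\|_M=\sqrt{(x,x)_M}=\|L^*x\|_2$; $L$ is any square matrix with $LL^*=M$, and $L^{-*}=(L^* )^{-1}$. Thin SVD: $\widetilde{U}\in\mathbb{C}^{n\times m}$ has orthonormal columns, $V\in\mathbb{C}^{m\times m}$ is unitary, $\Sigma=\mathrm{diag}(\sigma_1,\ldots,\sigma_m)$ with $\sigma_1\ge\cdots\ge\sigma_m\ge0$. $\widetilde{U}_k,V_k$ consist of the first $k$ columns of $\widetilde{U},V$, and $\Sigma_k=\mathrm{diag}(\sigma_1,\ldots,\sigma_k)$. The weighted Rayleigh quotient is $\widehat{U}_k^{[*]}\mathbb{A}\widehat{U}_k$, where $\widehat{U}_k^{[*]}=\widehat{U}_k^*M$ is the adjoint of $\widehat{U}_k$ as a map from $\mathbb{C}^k$ with the Euclidean inner product to $(\mathbb{C}^n,(\cdot,\cdot)_M)$. *)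

(* Defs.v *)
From HB Require Import structures.
From mathcomp Require Import all_boot all_order all_algebra.
From mathcomp Require Import sesquilinear spectral.
From mathcomp Require Import reals complex.

Set Implicit Arguments.
Unset Strict Implicit.
Unset Printing Implicit Defensive.
Import Order.TTheory GRing.Theory Num.Theory.
Local Open Scope ring_scope.
Local Open Scope sesquilinear_scope.
Local Open Scope complex_scope.

(* The complex numbers are [R[i]] for a [realType] [R]; vectors are column
   matrices and [A^t*] is the conjugate transpose.  In [R[i]] the inequality
   [0 <= z] also says that [z] is real, and norms are values in [R[i]]. *)

Definition wdot (R : realType) n (M : 'M[R[i]]_n) (x y : 'cV[R[i]]_n) : R[i] :=
  (y^t* *m M *m x) 0 0.

Definition wnorm (R : realType) n (M : 'M[R[i]]_n) (x : 'cV[R[i]]_n) : R[i] :=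
  sqrtC (wdot M x x).

Definition norm2 (R : realType) n (x : 'cV[R[i]]_n) : R[i] :=
  sqrtC (\sum_i `|x i 0| ^+ 2).

Definition hermitian_posdef (R : realType) n (M : 'M[R[i]]_n) : Prop :=
  M \is hermsymmx /\ forall x : 'cV[R[i]]_n, x != 0 -> 0 < wdot M x x.

Definition cdiag (R : realType) m (s : 'rV[R]_m) : 'M[R[i]]_m :=
  diag_mx (map_mx (real_complex R) s).

(* [unitarymx] asks for orthonormal rows, hence the explicit condition on the
   rectangular factor [U]. *)
Definition thin_svd (R : realType) n m (B : 'M[R[i]]_(n, m))
    (U : 'M[R[i]]_(n, m)) (s : 'rV[R]_m) (V : 'M[R[i]]_m) : Prop :=
  [/\ U^t* *m U = 1%:M,
      V \is unitarymx,
      forall i j : 'I_m, (i <= j)%N -> s 0 j <= s 0 i,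
      forall i : 'I_m, 0 <= s 0 i
    & B = U *m cdiag s *m V^t*].

Definition first_cols (T : Type) n m k (le_km : (k <= m)%N) (B : 'M[T]_(n, m)) :
    'M[T]_(n, k) :=
  colsub (widen_ord le_km) B.

Definition wadjoint (R : realType) n k (M : 'M[R[i]]_n) (U : 'M[R[i]]_(n, k)) :
    'M[R[i]]_(k, n) :=
  U^t* *m M.

Definition wrayleigh (R : realType) n k (M A : 'M[R[i]]_n)
    (U : 'M[R[i]]_(n, k)) : 'M[R[i]]_k :=
  wadjoint M U *m A *m U.

Definition wpod (R : realType) n k (L : 'M[R[i]]_n) (U : 'M[R[i]]_(n, k)) :
    'M[R[i]]_(n, k) :=
  invmx (L^t*) *m U.

Definition eigenpair (R : realType) k (S : 'M[R[i]]_k) (lambda : R[i])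
    (w : 'cV[R[i]]_k) : Prop :=
  S *m w = lambda *: w /\ w != 0.

(* Main.v *)
Require Import Defs.
From mathcomp Require Import all_boot all_order all_algebra.
From mathcomp Require Import sesquilinear spectral reals complex.

(** Put Uhat_k = L^-* U_k.  The whole statement rests on two identities.

    - Multiplying the decomposition L^* X = U Sigma V^* by V_k gives
      L^* X V_k = U_k Sigma_k [thin_svd_first_cols].  The singular values kept
      are all positive, so Sigma_k can be inverted, and
      Uhat_k = X V_k Sigma_k^-1: the weighted POD basis lies in the range of
      the snapshots X.  Hence A Uhat_k = Y V_k Sigma_k^-1, which no longer
      mentions A [mulmx_wpod_snapshots].

    - As M = L L^*, the map L^* is an isometry from the M-weighted inner
      product to the Euclidean one [wnorm_gram], and it sends Uhat_k to U_k.
      So the weighted adjoint of Uhat_k is U_k^* L^* [wadjoint_wpod], and the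
      weighted residual of a Ritz pair is the Euclidean norm of its image under
      L^*.

    Positive definiteness of M makes L^* invertible [posdef_factor_unit]. *)

Import Order.TTheory GRing.Theory Num.Theory.
Local Open Scope ring_scope.
Local Open Scope sesquilinear_scope.
Local Open Scope complex_scope.

Lemma mulmx_first_cols (T : pzSemiRingType) (p n m k : nat) (le_km : (k <= m)%N)
    (B : 'M[T]_(p, n)) (C : 'M[T]_(n, m)) :
  B *m first_cols le_km C = first_cols le_km (B *m C).
Proof.
by apply/matrixP => i j; rewrite !mxE; apply: eq_bigr => l _; rewrite mxE.
Qed.

Lemma first_cols_mul_cdiag (R : realType) (n m k : nat) (le_km : (k <= m)%N)
    (U : 'M[R[i]]_(n, m)) (s : 'rV[R]_m) :
  first_cols le_km (U *m cdiag s) =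
  first_cols le_km U *m cdiag (first_cols le_km s).
Proof. by apply/matrixP => i j; rewrite /cdiag !mul_mx_diag !mxE. Qed.

Lemma thin_svd_first_cols (R : realType) (n m k : nat) (le_km : (k <= m)%N)
    (B U : 'M[R[i]]_(n, m)) (s : 'rV[R]_m) (V : 'M[R[i]]_m) :
  thin_svd B U s V ->
  B *m first_cols le_km V = first_cols le_km U *m cdiag (first_cols le_km s).
Proof.
case=> _ V_unitary _ _ ->.
have VtV : V^t* *m V = 1%:M by apply/mulmx1C/unitarymxP.
by rewrite mulmx_first_cols -mulmxA VtV mulmx1 first_cols_mul_cdiag.
Qed.

(** The singular values decrease, so it is enough that the last one kept,
    of rank k, is positive. *)
Lemma cdiag_first_cols_unit (R : realType) (m k : nat) (le_km : (k <= m)%N)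
    (s : 'rV[R]_m) :
  (forall i j : 'I_m, (i <= j)%N -> s 0 j <= s 0 i) ->
  (forall i : 'I_m, i.+1 = k -> 0 < s 0 i) ->
  cdiag (first_cols le_km s) \in unitmx.
Proof.
move=> s_decr sk_gt0.
rewrite unitmxE det_diag unitfE; apply/prodf_neq0 => j _; rewrite !mxE.
have k_gt0 : (0 < k)%N by apply: leq_ltn_trans (ltn_ord j).
have lt_k1m : (k.-1 < m)%N by rewrite prednK.
have sj_gt0 : 0 < s 0 (widen_ord le_km j).
  apply: lt_le_trans (sk_gt0 (Ordinal lt_k1m) (prednK k_gt0)) (s_decr _ _ _).
  by rewrite /= -ltnS prednK.
by rewrite -(rmorph0 (real_complex R)) (inj_eq (fmorph_inj _)) gt_eqF.
Qed.

Lemma wdot_gram (R : realType) (n : nat) (L : 'M[R[i]]_n) (x : 'cV[R[i]]_n) :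
  wdot (L *m L^t*) x x = \sum_i `|(L^t* *m x) i 0| ^+ 2.
Proof.
have -> : wdot (L *m L^t*) x x = ((L^t* *m x)^t* *m (L^t* *m x)) 0 0.
  by rewrite /wdot trmx_mul map_mxM trmxCK !mulmxA.
by rewrite mxE; apply: eq_bigr => i _; rewrite !mxE normCK mulrC.
Qed.

Lemma wnorm_gram (R : realType) (n : nat) (L : 'M[R[i]]_n) (x : 'cV[R[i]]_n) :
  wnorm (L *m L^t*) x = norm2 (L^t* *m x).
Proof. by rewrite /wnorm wdot_gram. Qed.

(** A nonzero vector in the kernel of L^* would have weighted norm zero. *)
Lemma posdef_factor_unit (R : realType) (n : nat) (L : 'M[R[i]]_n) :
  hermitian_posdef (L *m L^t*) -> L^t* \in unitmx.
Proof.
case=> _ posM; rewrite -unitmx_tr -row_free_unit -kermx_eq0.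
apply/rowV0P => v /sub_kermxP vL0; apply/eqP/negPn/negP => v_neq0.
have Lv0 : L^t* *m v^T = 0.
  by apply: trmx_inj; rewrite trmx_mul trmxK vL0 trmx0.
have := posM v^T; rewrite trmx_eq0 => /(_ v_neq0).
rewrite wdot_gram Lv0 big1 ?ltxx // => i _.
by rewrite mxE normr0 expr0n.
Qed.

Lemma mulmx_wpod (R : realType) (n k : nat) (L : 'M[R[i]]_n)
    (U : 'M[R[i]]_(n, k)) :
  L^t* \in unitmx -> L^t* *m wpod L U = U.
Proof. by move=> L_unit; rewrite /wpod mulKVmx. Qed.

Lemma wadjoint_wpod (R : realType) (n k : nat) (L : 'M[R[i]]_n)
    (U : 'M[R[i]]_(n, k)) :
  L^t* \in unitmx -> wadjoint (L *m L^t*) (wpod L U) = U^t* *m L^t*.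
Proof.
move=> L_unit; rewrite -{2}(mulmx_wpod _ _ _ L U L_unit) /wadjoint.
by rewrite [in RHS]trmx_mul map_mxM trmxCK !mulmxA.
Qed.

Lemma mulmx_wpod_snapshots (R : realType) (n m k : nat) (A L : 'M[R[i]]_n)
    (X : 'M[R[i]]_(n, m)) (U : 'M[R[i]]_(n, k)) (V : 'M[R[i]]_(m, k))
    (D : 'M[R[i]]_k) :
  L^t* \in unitmx -> D \in unitmx -> L^t* *m X *m V = U *m D ->
  A *m wpod L U = A *m X *m V *m invmx D.
Proof.
move=> L_unit D_unit LXV; rewrite -!mulmxA; congr (A *m _).
rewrite /wpod -(mulmxK D_unit U) -LXV.
by rewrite -!mulmxA mulKmx.
Qed.

Theorem proposition8p1 (R : realType) (n m : nat) (lt_mn : (m < n)%N)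
    (A : 'M[R[i]]_n) (X Y : 'M[R[i]]_(n, m)) (hY : Y = A *m X)
    (M L : 'M[R[i]]_n) (hM : hermitian_posdef M) (hL : M = L *m L^t*)
    (U : 'M[R[i]]_(n, m)) (s : 'rV[R]_m) (V : 'M[R[i]]_m)
    (hsvd : thin_svd (L^t* *m X) U s V)
    (k : nat) (k_gt0 : (0 < k)%N) (le_km : (k <= m)%N)
    (sk_gt0 : forall i : 'I_m, i.+1 = k -> 0 < s 0 i) :
  let Uk := first_cols le_km U in
  let Vk := first_cols le_km V in
  let Sigmak := cdiag (first_cols le_km s) in
  let Uhat := wpod L Uk in
  let Shat := wrayleigh M A Uhat in
  Shat = Uk^t* *m L^t* *m Y *m Vk *m invmx Sigmak /\
  (forall (lambda : R[i]) (w : 'cV[R[i]]_k),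
     eigenpair Shat lambda w ->
     wnorm M (A *m (Uhat *m w) - lambda *: (Uhat *m w)) =
     norm2 (L^t* *m Y *m Vk *m invmx Sigmak *m w - lambda *: (Uk *m w))).
Proof.
move=> Uk Vk Sigmak Uhat Shat.
have L_unit : L^t* \in unitmx by apply: posdef_factor_unit; rewrite -hL.
have Sigmak_unit : Sigmak \in unitmx.
  by case: hsvd => _ _ s_decr _ _; apply: cdiag_first_cols_unit.
have AUhat : A *m Uhat = Y *m Vk *m invmx Sigmak.
  rewrite hY; apply: mulmx_wpod_snapshots => //.
  exact: thin_svd_first_cols hsvd.
split=> [|lambda w _].
  by rewrite /Shat /wrayleigh hL wadjoint_wpod // -mulmxA AUhat !mulmxA.
rewrite hL wnorm_gram mulmxBr -scalemxAr; congr (norm2 (_ - _ *: _)).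
  by rewrite (mulmxA A) AUhat !mulmxA.
by rewrite mulmxA mulmx_wpod.
Qed.
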